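(* Let $r\ge2$ be an integer, $\phi(z)=\mu z$ with $\mu=e^{2\pi i/r}$, and $\psi(z)=g(z^r)$ for some $g\in M(\mathcal{D})$, such that $C_{\psi,\phi}$ is a bounded operator on $\mathcal{D}$. Then $$W(C_{\psi,\phi})=\left(\mu^0W(M_\psi|_{P_0})\cup\mu^1W(M_\psi|_{P_1})\cup\cdots\cup\mu^{r-1}W(M_\psi|_{P_{r-1}})\right)^{\wedge}.$$
   Context: $\mathbb{D}=\{z\in\mathbb{C}:|z|<1\}$. The Dirichlet space $\mathcal{D}$ is the Hilbert space of all holomorphic $f(z)=\sum_{n\ge0}\hat f_nz^n$ on $\mathbb{D}$ with $\sum_{n\ge 0}(n+1)|\hat f_n|^2<\infty$ (equivalently $\int_{\mathbb{D}}|f'|^2dA<\infty$), with inner product $\langle f,g\rangle_{\mathcal{D}}=\sum_{n\ge0}(n+1)\hat f_n\overline{\hat g_n}$. $M(\mathcal{D})$ is the multiplier algebra, i.e. the set of functions $h:\mathbb{D}\to\mathbb{C}$ with $hf\in\mathcal{D}$ for every $f\in\mathcal{D}$; $M_\psi f=\psi f$ is the multiplication operator. The weighted composition operator is $(C_{\psi,\phi}f)(z)=\psi(z)f(\phi(z))$. For $0\le j<r$, $P_j=\{f: f(z)=z^jg(z^r),\ g\in\mathcal{D}\}$, a closed subspace of $\mathcal{D}$; $M_\psi|_{P_j}$ is the restriction of $M_\psi$ to $P_j$ (which maps $P_j$ to itself for the $\psi$ considered), regarded as an operator on $P_j$. The numerical range of a bounded operator $T$ on a Hilbert space $\mathcal{H}$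 is $W(T)=\{\langle Tf,f\rangle:f\in\mathcal{H},\|f\|=1\}$. For $S\subseteq\mathbb{C}$, $S^{\wedge}$ denotes the convex hull of $S$, and for $\lambda \in\mathbb{C}$, $\lambda S=\{\lambda s:s\in S\}$. *)

(* Defs.v *)
(* Stdlib reals with Coquelicot's complex numbers. *)
From Stdlib Require Import Reals.
From Coquelicot Require Import Coquelicot.

Local Open Scope C_scope.

Definition unit_disc (z : C) : Prop := (Cmod z < 1)%R.

(* A function on the disc is represented by a total function [C -> C]; every
   notion below only looks at its values on [unit_disc]. *)
Definition holomorphic_on_disc (f : C -> C) : Prop :=
  forall z : C, unit_disc z -> ex_derive f z.

Definition power_series_on_disc (a : nat -> C) (f : C -> C) : Prop :=
  forall z : C, unit_disc z ->
    is_pseries (K := C_AbsRing) (V := C_NormedModule) a z (f z).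

Definition dirichlet (f : C -> C) : Prop :=
  holomorphic_on_disc f /\
  exists a : nat -> C,
    power_series_on_disc a f /\
    ex_series (fun n : nat => (INR (S n) * Cmod (a n) ^ 2)%R).

(* [is_dirichlet_inner f g w] reads <f, g> = w, linear in the first argument;
   the coefficient sequences are unique. *)
Definition is_dirichlet_inner (f g : C -> C) (w : C) : Prop :=
  dirichlet f /\ dirichlet g /\
  exists a b : nat -> C,
    power_series_on_disc a f /\
    power_series_on_disc b g /\
    is_series (K := C_AbsRing) (V := C_NormedModule)
      (fun n : nat => RtoC (INR (S n)) * a n * Cconj (b n)) w.

Definition is_dirichlet_norm (f : C -> C) (N : R) : Prop :=
  (0 <= N)%R /\ is_dirichlet_inner f f (RtoC (N ^ 2)).

Definition multiplier (h : C -> C) : Prop :=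
  forall f : C -> C, dirichlet f -> dirichlet (fun z => h z * f z).

Definition mul_op (psi f : C -> C) : C -> C := fun z => psi z * f z.

Definition wcomp_op (psi phi f : C -> C) : C -> C := fun z => psi z * f (phi z).

Definition linear_on_dirichlet (T : (C -> C) -> (C -> C)) : Prop :=
  forall (f g : C -> C) (c d : C), dirichlet f -> dirichlet g ->
    forall z : C, unit_disc z ->
      T (fun u => c * f u + d * g u) z = c * T f z + d * T g z.

Definition bounded_operator (T : (C -> C) -> (C -> C)) : Prop :=
  (forall f : C -> C, dirichlet f -> dirichlet (T f)) /\
  linear_on_dirichlet T /\
  exists M : R, forall (f : C -> C) (N N' : R),
    is_dirichlet_norm f N -> is_dirichlet_norm (T f) N' -> (N' <= M * N)%R.

Definition P_space (r j : nat) (f : C -> C) : Prop :=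
  exists g : C -> C, dirichlet g /\
    forall z : C, unit_disc z -> f z = Cpow z j * g (Cpow z r).

(* Numerical range of [T] restricted to the subspace [H] of the Dirichlet
   space, with the inherited inner product. *)
Definition numerical_range (H : (C -> C) -> Prop) (T : (C -> C) -> (C -> C))
    (w : C) : Prop :=
  exists f : C -> C,
    H f /\ is_dirichlet_norm f 1 /\ is_dirichlet_inner (T f) f w.

Definition scale_set (c : C) (S : C -> Prop) (w : C) : Prop :=
  exists s : C, S s /\ w = c * s.

Definition convex_set (S : C -> Prop) : Prop :=
  forall (x y : C) (t : R), S x -> S y -> (0 <= t <= 1)%R ->
    S (RtoC t * x + RtoC (1 - t) * y).

Definition convex_hull (S : C -> Prop) (w : C) : Prop :=
  forall K : C -> Prop, convex_set K -> (forall s : C, S s -> K s) -> K w.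

Definition cexp (z : C) : C :=
  ((exp (Re z) * cos (Im z))%R, (exp (Re z) * sin (Im z))%R).

(* Main.v *)
Require Import Defs.
From Stdlib Require Import Reals Lra Lia IndefiniteDescription.
From Coquelicot Require Import Coquelicot.

(** Write [T f = psi (f o phi)]. A function of [P_j] is an eigenfunction of the
    rotation [f |-> f (mu z)] for the eigenvalue [mu ^ j], because [mu ^ r = 1];
    hence [T] acts on [P_j] as [mu ^ j] times multiplication by [psi], and, as
    [psi (mu z) = psi z], it maps [P_j] to the same eigenspace. The [n]th
    Taylor coefficient of such an eigenfunction vanishes unless
    [mu ^ n = mu ^ j], so eigenspaces for distinct powers of [mu] are orthogonal
    ([homogeneous_orthogonal]).

    A unit vector [f] is the sum of its parts [f_j] in [P_j], [j < r], obtained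
    by keeping the Taylor coefficients whose index is [j] modulo [r]
    ([P_space_residue_part], [Csum_residue_functions]). By orthogonality
    [<T f, f>] is the sum of the [<T f_j, f_j>] and the weights
    [t_j = ||f_j||^2] add up to 1. Normalising the nonzero [f_j] exhibits
    [<T f, f>] as a convex combination, with weights [t_j], of points of
    [mu ^ j W(M_psi | P_j)] ([convex_set_Csum]).

    Conversely a unit vector of [P_j] is a unit vector of the whole space, so
    [mu ^ j W(M_psi | P_j)] lies in [W(T)], and [W(T)] is convex by the
    Toeplitz-Hausdorff theorem ([numerical_range_convex]).

    The analytic input is that functions on the disc and coefficient sequences
    can be exchanged freely: square-summability with weights [n + 1] makes the
    power series converge on the disc to a complex differentiable function
    ([dirichlet_CPSeries]), and the sum determines the coefficients
    ([power_series_coef_unique]). *)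

Local Open Scope C_scope.

(** * Complex series *)

Local Notation is_Cseries :=
  (@is_series C_AbsRing C_NormedModule).

Lemma Cconj_RtoC (x : R) : Cconj (RtoC x) = RtoC x.
Proof. unfold Cconj, RtoC. simpl. now rewrite Ropp_0. Qed.

Lemma Re_sum_n (a : nat -> C) n :
  Re (@sum_n C_NormedModule a n) = sum_n (fun k => Re (a k)) n.
Proof.
  induction n as [|n IH].
  - now rewrite !sum_O.
  - rewrite !sum_Sn, <- IH. reflexivity.
Qed.

Lemma Im_sum_n (a : nat -> C) n :
  Im (@sum_n C_NormedModule a n) = sum_n (fun k => Im (a k)) n.
Proof.
  induction n as [|n IH].
  - now rewrite !sum_O.
  - rewrite !sum_Sn, <- IH. reflexivity.
Qed.

Lemma is_Cseries_Re_Im (a : nat -> C) (l : C) :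
  is_Cseries a l <->
  is_series (fun n => Re (a n)) (Re l) /\ is_series (fun n => Im (a n)) (Im l).
Proof.
  unfold is_series. split.
  - intros H0. assert (H := proj1 (@filterlim_locally _ C_UniformSpace _ _ _ _) H0).
    split; apply filterlim_locally; intros eps; generalize (H eps);
      apply filter_imp; intros n [H1 H2].
    + rewrite <- Re_sum_n. exact H1.
    + rewrite <- Im_sum_n. exact H2.
  - intros [H1' H2'].
    assert (H1 := proj1 (@filterlim_locally _ R_UniformSpace _ _ _ _) H1').
    assert (H2 := proj1 (@filterlim_locally _ R_UniformSpace _ _ _ _) H2').
    apply (proj2 (@filterlim_locally _ C_UniformSpace _ _ _ _)); intros eps.
    generalize (filter_and _ _ (H1 eps) (H2 eps)); apply filter_imp.
    intros n [K1 K2]. rewrite <- Re_sum_n in K1. rewrite <- Im_sum_n in K2.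
    split; assumption.
Qed.

Lemma is_Cseries_unique (a : nat -> C) (l l' : C) :
  is_Cseries a l -> is_Cseries a l' -> l = l'.
Proof. apply filterlim_locally_unique. Qed.

Lemma is_Cseries_ext (a b : nat -> C) (l : C) :
  (forall n, a n = b n) -> is_Cseries a l -> is_Cseries b l.
Proof. apply is_series_ext. Qed.

Lemma is_Cseries_plus (a b : nat -> C) (la lb : C) :
  is_Cseries a la -> is_Cseries b lb ->
  is_Cseries (fun n => a n + b n) (la + lb).
Proof. apply (@is_series_plus C_AbsRing C_NormedModule). Qed.

Lemma is_Cseries_scal (c : C) (a : nat -> C) (l : C) :
  is_Cseries a l -> is_Cseries (fun n => c * a n) (c * l).
Proof. apply (@is_series_scal_l C_AbsRing C_NormedModule). Qed.

Lemma is_Cseries_conj (a : nat -> C) (l : C) :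
  is_Cseries a l -> is_Cseries (fun n => Cconj (a n)) (Cconj l).
Proof.
  rewrite !is_Cseries_Re_Im. intros [H1 H2]. split.
  - exact H1.
  - exact (is_series_opp _ _ H2).
Qed.

Lemma is_Cseries_RtoC (a : nat -> R) (l : R) :
  is_series a l -> is_Cseries (fun n => RtoC (a n)) (RtoC l).
Proof.
  intros H. apply is_Cseries_Re_Im; split; [exact H|].
  apply (is_series_ext (fun n => 0 * a n)%R); [intros n; apply Rmult_0_l|].
  change (is_series (fun n => 0 * a n)%R 0%R).
  assert (E := @is_series_scal_l R_AbsRing R_NormedModule 0%R a l H).
  change (scal 0%R l) with (0 * l)%R in E. now rewrite Rmult_0_l in E.
Qed.

Definition CSeries (a : nat -> C) : C :=
  (Series (fun n => Re (a n)), Series (fun n => Im (a n))).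

Lemma CSeries_correct (a : nat -> C) (b : nat -> R) :
  (forall n, Cmod (a n) <= b n)%R -> ex_series b -> is_Cseries a (CSeries a).
Proof.
  intros Hab Hb. apply is_Cseries_Re_Im.
  split; apply Series_correct;
    apply (@ex_series_le R_AbsRing R_CompleteNormedModule _ b); trivial; intros n;
    apply Rle_trans with (2 := Hab n); apply Rle_trans with (2 := Rmax_Cmod (a n)).
  - apply Rmax_l.
  - apply Rmax_r.
Qed.

Lemma is_Cseries_Cmod_le (a : nat -> C) (b : nat -> R) (l : C) (L : R) :
  (forall n, Cmod (a n) <= b n)%R -> is_Cseries a l -> is_series b L ->
  (Cmod l <= L)%R.
Proof.
  intros Hab Ha Hb.
  assert (H1 : is_lim_seq (fun n => Cmod (@sum_n C_NormedModule a n)) (Cmod l)).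
  { exact (filterlim_comp _ _ _ _ _ _ _ _ Ha (@filterlim_norm C_AbsRing C_NormedModule l)). }
  assert (H2 : is_lim_seq (fun n => sum_n b n) L) by exact Hb.
  apply (is_lim_seq_le _ _ _ _) with (2 := H1) (3 := H2).
  intros n.
  apply Rle_trans with (1 := @norm_sum_n_m C_AbsRing C_NormedModule a 0 n).
  apply sum_n_m_le. exact Hab.
Qed.

(** * Complex power series *)

Lemma is_Cpseries_iff (a : nat -> C) (z l : C) :
  @is_pseries C_AbsRing C_NormedModule a z l <->
  is_Cseries (fun n => a n * z ^ n) l.
Proof.
  assert (E : forall n, @scal C_Ring C_ModuleSpace (@pow_n C_Ring z n) (a n) = a n * z ^ n).
  { intros n.
    assert (E : @pow_n C_Ring z n = z ^ n).
    { induction n as [|n IH]; [reflexivity|]. simpl. rewrite IH. reflexivity. }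
    rewrite E. apply Cmult_comm. }
  unfold is_pseries. split; apply is_Cseries_ext; intros n; [|symmetry]; apply E.
Qed.

Lemma unit_disc_R (x : R) : (Rabs x < 1)%R -> unit_disc (RtoC x).
Proof. unfold unit_disc. now rewrite Cmod_R. Qed.

Lemma CV_radius_gt_0 (a : nat -> R) (x : R) :
  (0 < x)%R -> ex_pseries a x -> Rbar_lt 0 (CV_radius a).
Proof.
  intros Hx Ha. apply Rbar_lt_le_trans with (Finite x); [exact Hx|].
  apply Rbar_not_lt_le. intros H.
  replace x with (Rabs x) in H by (apply Rabs_pos_eq; lra).
  apply (CV_disk_outside _ _ H). apply ex_series_lim_0.
  destruct Ha as [l Hl]. exists l. now apply is_pseries_R.
Qed.

(** At real points of the disc the real and imaginary parts of the sum are
    real power series with coefficients [Re (a n)] and [Im (a n)], so the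
    identity theorem for real power series applies to each of them. *)
Lemma power_series_coef_unique (a b : nat -> C) (f : C -> C) :
  power_series_on_disc a f -> power_series_on_disc b f -> forall n, a n = b n.
Proof.
  intros Ha Hb.
  assert (K : forall c, power_series_on_disc c f -> forall x : R, (Rabs x < 1)%R ->
     is_pseries (fun n => Re (c n)) x (Re (f (RtoC x))) /\
     is_pseries (fun n => Im (c n)) x (Im (f (RtoC x)))).
  { intros c Hc x Hx. generalize (Hc _ (unit_disc_R _ Hx)).
    rewrite is_Cpseries_iff, is_Cseries_Re_Im. intros [H1 H2].
    split; apply is_pseries_R.
    - apply is_series_ext with (2 := H1). intros n.
      rewrite <- RtoC_pow. apply re_scal_r.
    - apply is_series_ext with (2 := H2). intros n.
      rewrite <- RtoC_pow, im_mult; simpl; ring. }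
  assert (half : (Rabs (1/2) < 1)%R) by (rewrite Rabs_pos_eq; lra).
  assert (U : forall p : C -> R,
    (forall c, power_series_on_disc c f -> forall x : R, (Rabs x < 1)%R ->
       is_pseries (fun n => p (c n)) x (p (f (RtoC x)))) ->
    forall n, p (a n) = p (b n)).
  { intros p Hp n.
    assert (R0 : forall c, power_series_on_disc c f ->
              Rbar_lt 0 (CV_radius (fun n => p (c n)))).
    { intros c Hc. apply CV_radius_gt_0 with (1/2)%R; [lra|].
      eexists. now apply Hp. }
    apply (PSeries_ext_recip (fun n => p (a n)) (fun n => p (b n))).
    - now apply R0.
    - now apply R0.
    - exists (mkposreal 1 Rlt_0_1). intros x Hx.
      assert (Hx' : (Rabs x < 1)%R).
      { change (Rabs (x - 0) < 1)%R in Hx. now rewrite Rminus_0_r in Hx. }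
      rewrite (is_pseries_unique _ _ _ (Hp a Ha x Hx')).
      now rewrite (is_pseries_unique _ _ _ (Hp b Hb x Hx')). }
  intros n.
  assert (E1 := U Re (fun c Hc x Hx => proj1 (K c Hc x Hx)) n).
  assert (E2 := U Im (fun c Hc x Hx => proj2 (K c Hc x Hx)) n).
  destruct (a n), (b n). simpl in *. congruence.
Qed.

(** The second derivative of the geometric series; its terms dominate [n ^ 2 rho ^ n],
    the size of the quadratic remainders below. *)
Lemma ex_series_pow_quad (rho : R) : (0 <= rho < 1)%R ->
  ex_series (fun n => INR (S n) * INR (S (S n)) * rho ^ n)%R.
Proof.
  intros Hr.
  assert (H : Rbar_lt (Rabs rho) (CV_radius (PS_derive (PS_derive (fun _ => 1%R))))).
  { rewrite !CV_radius_derive.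
    apply Rbar_lt_le_trans with (Finite ((1 + rho) / 2)).
    - rewrite Rabs_pos_eq; simpl; lra.
    - apply (proj1 (CV_radius_bounded (fun _ => 1%R))). exists 1%R. intros n.
      rewrite Rmult_1_l, Rabs_pos_eq by (apply pow_le; lra).
      apply Rle_trans with (1 ^ n)%R; [apply pow_incr; lra|rewrite pow1; lra]. }
  apply CV_disk_inside in H. apply ex_series_ext with (2 := H).
  intros n. unfold PS_derive. rewrite Rabs_pos_eq.
  { change (INR (S n) * (INR (S (S n)) * 1) * rho ^ n = INR (S n) * INR (S (S n)) * rho ^ n)%R. ring. }
  apply Rmult_le_pos; [|apply pow_le; lra].
  repeat apply Rmult_le_pos; try apply pos_INR; lra.
Qed.

(** Writing [e n] for the first order Taylor remainder of [w ^ n] at [z], one has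
    [e (n + 1) = w e n + n (w - z) ^ 2 z ^ (n - 1)], and the bound follows by
    induction. The factor [rho ^ 2] on the left stands for the exponent [n - 2]
    of [rho] on the right, which would be negative for small [n]. *)
Lemma pow_remainder (rho : R) (z w : C) (n : nat) :
  (0 < rho)%R -> (Cmod z <= rho)%R -> (Cmod w <= rho)%R ->
  (rho ^ 2 * Cmod (w ^ n - z ^ n - INR n * (w - z) * z ^ pred n) <=
   INR n ^ 2 * Cmod (w - z) ^ 2 * rho ^ n)%R.
Proof.
  intros Hr Hz Hw. induction n as [|n IH].
  - simpl Cpow. simpl INR. replace (1 - 1 - RtoC 0 * (w - z) * 1) with (RtoC 0) by ring.
    rewrite Cmod_0. simpl. lra.
  - assert (E : w ^ S n - z ^ S n - INR (S n) * (w - z) * z ^ pred (S n) =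
      w * (w ^ n - z ^ n - INR n * (w - z) * z ^ pred n) +
      INR n * (w - z) * (w - z) * z ^ pred n).
    { destruct n as [|n]; simpl pred.
      - simpl. ring.
      - rewrite !S_INR, !RtoC_plus, !Cpow_S. ring. }
    rewrite E. clear E.
    set (e := w ^ n - z ^ n - INR n * (w - z) * z ^ pred n) in *.
    assert (B : (rho ^ 2 * Cmod (INR n * (w - z) * (w - z) * z ^ pred n) <=
                 INR n * Cmod (w - z) ^ 2 * rho ^ S n)%R).
    { rewrite !Cmod_mult, Cmod_R, Cmod_pow, Rabs_pos_eq by apply pos_INR.
      destruct n as [|n]; [simpl; lra|]. simpl pred.
      apply Rle_trans with (rho ^ 2 * (INR (S n) * Cmod (w - z) * Cmod (w - z) * rho ^ n))%R.
      - apply Rmult_le_compat_l; [nra|]. apply Rmult_le_compat_l.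
        + repeat apply Rmult_le_pos; try apply pos_INR; apply Cmod_ge_0.
        + apply pow_incr. split; [apply Cmod_ge_0|exact Hz].
      - right. simpl. ring. }
    assert (A : (rho ^ 2 * Cmod (w * e) <= rho * (INR n ^ 2 * Cmod (w - z) ^ 2 * rho ^ n))%R).
    { rewrite Cmod_mult.
      apply Rle_trans with (rho * (rho ^ 2 * Cmod e))%R.
      - assert (0 <= rho ^ 2 * Cmod e)%R by (apply Rmult_le_pos; [nra|apply Cmod_ge_0]). nra.
      - apply Rmult_le_compat_l; [lra|exact IH]. }
    apply Rle_trans with (rho ^ 2 * (Cmod (w * e) + Cmod (INR n * (w - z) * (w - z) * z ^ pred n)))%R.
    { apply Rmult_le_compat_l; [nra|apply Cmod_triangle]. }
    rewrite Rmult_plus_distr_l.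
    apply Rle_trans with (1 := Rplus_le_compat _ _ _ _ A B).
    rewrite S_INR. simpl (rho ^ S n)%R.
    assert (0 <= Cmod (w - z) ^ 2 * (rho * rho ^ n))%R.
    { apply Rmult_le_pos; [apply pow2_ge_0|]. apply Rmult_le_pos; [lra|apply pow_le; lra]. }
    generalize (pos_INR n). nra.
Qed.

Definition CPSeries (a : nat -> C) (z : C) : C := CSeries (fun n => a n * z ^ n).

Lemma CPSeries_correct (a : nat -> C) (M : R) :
  (forall n, Cmod (a n) <= M)%R -> power_series_on_disc a (CPSeries a).
Proof.
  intros a_le z Hz.
  assert (M_ge_0 := Rle_trans _ _ _ (Cmod_ge_0 _) (a_le 0%nat)). apply is_Cpseries_iff.
  apply CSeries_correct with (fun n => M * (INR (S n) * INR (S (S n)) * Cmod z ^ n))%R.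
  - intros n. rewrite Cmod_mult, Cmod_pow.
    assert (0 <= Cmod z ^ n)%R by (apply pow_le, Cmod_ge_0).
    apply Rle_trans with (M * Cmod z ^ n)%R.
    + apply Rmult_le_compat_r; trivial.
    + apply Rmult_le_compat_l; trivial.
      rewrite !S_INR. generalize (pos_INR n). intros. nra.
  - apply (@ex_series_scal_l R_AbsRing R_NormedModule M). apply ex_series_pow_quad.
    split; [apply Cmod_ge_0|exact Hz].
Qed.

(** Summing [pow_remainder] over [n], the increment of the sum minus the
    termwise derivative [D] is [O (|w - z| ^ 2)] on a disc of radius [rho < 1]
    around the origin that contains [z]. *)
Lemma CPSeries_holomorphic (a : nat -> C) (M : R) :
  (forall n, Cmod (a n) <= M)%R -> holomorphic_on_disc (CPSeries a).
Proof.
  intros a_le z Hz.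
  assert (M_ge_0 := Rle_trans _ _ _ (Cmod_ge_0 _) (a_le 0%nat)). unfold unit_disc in Hz.
  set (rho := ((1 + Cmod z) / 2)%R).
  assert (Hz0 := Cmod_ge_0 z).
  assert (Hrho : (0 < rho < 1)%R) by (unfold rho; lra).
  assert (Hzr : (Cmod z < rho)%R) by (unfold rho; lra).
  assert (Hrn : forall n, (0 <= rho ^ n)%R) by (intros; apply pow_le; lra).
  destruct (ex_series_pow_quad rho) as [L HL]; [lra|].
  set (q := fun n => (INR (S n) * INR (S (S n)) * rho ^ n)%R) in HL.
  set (D := CSeries (fun n => a n * (INR n * z ^ pred n))).
  assert (HD : is_Cseries (fun n => a n * (INR n * z ^ pred n)) D).
  { apply CSeries_correct with (fun n => (M / rho) * q n)%R.
    - intros n. rewrite !Cmod_mult, Cmod_R, Cmod_pow, Rabs_pos_eq by apply pos_INR.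
      apply Rle_trans with (M * (INR n * Cmod z ^ pred n))%R.
      + apply Rmult_le_compat_r; [|apply a_le].
        apply Rmult_le_pos; [apply pos_INR|apply pow_le, Hz0].
      + apply Rle_trans with (M * (/ rho * q n))%R; [|right; unfold Rdiv; ring].
        apply Rmult_le_compat_l; [exact M_ge_0|].
        apply Rmult_le_reg_l with rho; [lra|].
        rewrite <- (Rmult_assoc rho (/ rho)), Rinv_r, Rmult_1_l by lra.
        unfold q. destruct n as [|n].
        * simpl. lra.
        * simpl pred.
          apply Rle_trans with (INR (S n) * rho ^ S n)%R.
          -- simpl (rho ^ S n)%R.
             assert (Cmod z ^ n <= rho ^ n)%R by (apply pow_incr; lra).
             assert (0 <= rho * INR (S n))%R by (apply Rmult_le_pos; [lra|apply pos_INR]).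
             nra.
          -- apply Rmult_le_compat_r; [apply Hrn|].
             rewrite !S_INR. generalize (pos_INR n). nra.
    - apply (@ex_series_scal_l R_AbsRing R_NormedModule (M / rho)%R). now exists L. }
  assert (M0 := M_ge_0).
  assert (Lpos : (0 <= L)%R).
  { apply (is_lim_seq_le (fun _ => 0%R) (sum_n q) 0%R L).
    - intros n.
      apply Rle_trans with (sum_n (fun _ => 0%R) n).
      + rewrite sum_n_const. lra.
      + apply sum_n_m_le. intros k. unfold q.
        repeat apply Rmult_le_pos; try apply pos_INR; apply Hrn.
    - apply is_lim_seq_const.
    - exact HL. }
  set (B := (M * L / rho ^ 2)%R).
  assert (HB : (0 <= B)%R).
  { unfold B. apply Rmult_le_pos; [apply Rmult_le_pos; trivial|].
    apply Rlt_le, Rinv_0_lt_compat. nra. }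
  assert (Q : forall w, (Cmod w < rho)%R ->
     (Cmod (CPSeries a w - CPSeries a z - (w - z) * D) <= B * Cmod (w - z) ^ 2)%R).
  { intros w Hw.
    assert (Sw := CPSeries_correct a M a_le w (Rlt_trans _ _ _ Hw (proj2 Hrho))).
    assert (Sz := CPSeries_correct a M a_le z Hz).
    rewrite is_Cpseries_iff in Sw, Sz.
    assert (S : is_Cseries (fun n => a n * (w ^ n - z ^ n - INR n * (w - z) * z ^ pred n))
                  (CPSeries a w - CPSeries a z - (w - z) * D)).
    { generalize (is_Cseries_plus _ _ _ _ Sw
         (is_Cseries_plus _ _ _ _ (is_Cseries_scal (-(1)) _ _ Sz)
            (is_Cseries_scal (- (w - z)) _ _ HD))).
      intros S.
      replace (CPSeries a w - CPSeries a z - (w - z) * D)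
        with (CPSeries a w + (- (1) * CPSeries a z + - (w - z) * D)) by ring.
      apply is_Cseries_ext with (2 := S). intros n. ring. }
    set (k := (M * Cmod (w - z) ^ 2 / rho ^ 2)%R).
    apply Rle_trans with (k * L)%R; [|right; unfold k, B; field; lra].
    apply is_Cseries_Cmod_le with (2 := S) (b := fun n => (k * q n)%R).
    - intros n. rewrite Cmod_mult.
      apply Rle_trans with (M * Cmod (w ^ n - z ^ n - INR n * (w - z) * z ^ pred n))%R.
      { apply Rmult_le_compat_r; [apply Cmod_ge_0|apply a_le]. }
      unfold k. replace (M * Cmod (w - z) ^ 2 / rho ^ 2 * q n)%R
        with (M * (Cmod (w - z) ^ 2 * q n / rho ^ 2))%R by (field; lra).
      apply Rmult_le_compat_l; trivial.
      apply Rmult_le_reg_l with (rho ^ 2)%R; [nra|].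
      apply Rle_trans with (1 := pow_remainder rho z w n (proj1 Hrho) (Rlt_le _ _ Hzr) (Rlt_le _ _ Hw)).
      replace (rho ^ 2 * (Cmod (w - z) ^ 2 * q n / rho ^ 2))%R
        with (Cmod (w - z) ^ 2 * q n)%R by (field; lra).
      replace (INR n ^ 2 * Cmod (w - z) ^ 2 * rho ^ n)%R
        with (Cmod (w - z) ^ 2 * (INR n ^ 2 * rho ^ n))%R by ring.
      apply Rmult_le_compat_l; [apply pow2_ge_0|]. unfold q.
      apply Rmult_le_compat_r; [apply Hrn|].
      rewrite !S_INR. generalize (pos_INR n). nra.
    - now apply (@is_series_scal_l R_AbsRing R_NormedModule k). }
  exists D. split.
  { apply is_linear_scal_l. }
  intros x Hx.
  assert (Ex := @is_filter_lim_locally_unique C_AbsRing (AbsRing_NormedModule C_AbsRing) _ _ Hx).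
  subst x. intros eps.
  assert (Hd : (0 < Rmin (rho - Cmod z) (eps / (B + 1)))%R).
  { apply Rmin_case; [lra|]. apply Rdiv_lt_0_compat; [apply cond_pos|lra]. }
  exists (mkposreal _ Hd). intros w Hw.
  change (Cmod (w - z) < Rmin (rho - Cmod z) (eps / (B + 1)))%R in Hw.
  change (Cmod (CPSeries a w - CPSeries a z - (w - z) * D) <= eps * Cmod (w - z))%R.
  assert (H1 := Rlt_le_trans _ _ _ Hw (Rmin_l _ _)).
  assert (H2 := Rlt_le_trans _ _ _ Hw (Rmin_r _ _)).
  assert (Hw' : (Cmod w < rho)%R).
  { replace w with (z + (w - z)) by ring.
    apply Rle_lt_trans with (1 := Cmod_triangle _ _). lra. }
  apply Rle_trans with (1 := Q w Hw').
  assert (H3 := Cmod_ge_0 (w - z)).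
  apply Rlt_div_r in H2; [|lra].
  replace (B * Cmod (w - z) ^ 2)%R with ((B * Cmod (w - z)) * Cmod (w - z))%R by ring.
  apply Rmult_le_compat_r; [exact H3|nra].
Qed.

(** * The Dirichlet space *)

Definition weighted_l2 (a : nat -> C) : Prop :=
  ex_series (fun n => INR (S n) * Cmod (a n) ^ 2)%R.

Lemma sum_n_le_series (b : nat -> R) (L : R) (n : nat) :
  (forall k, 0 <= b k)%R -> is_series b L -> (sum_n b n <= L)%R.
Proof.
  intros Hb HL. apply (is_lim_seq_incr_compare (sum_n b) L HL).
  intros k. rewrite sum_Sn. change (sum_n b k <= sum_n b k + b (S k))%R.
  generalize (Hb (S k)). lra.
Qed.

Lemma term_le_sum_n (b : nat -> R) (n : nat) :
  (forall k, 0 <= b k)%R -> (b n <= sum_n b n)%R.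
Proof.
  intros Hb. destruct n as [|n]; [rewrite sum_O; lra|].
  rewrite sum_Sn. change (b (S n) <= sum_n b n + b (S n))%R.
  assert (0 <= sum_n b n)%R; [|lra].
  clear -Hb. induction n as [|n IH]; [rewrite sum_O; apply Hb|].
  rewrite sum_Sn. change (0 <= sum_n b n + b (S n))%R.
  generalize (Hb (S n)). lra.
Qed.

Lemma weight_term_ge_0 (a : nat -> C) (n : nat) :
  (0 <= INR (S n) * Cmod (a n) ^ 2)%R.
Proof. apply Rmult_le_pos; [apply pos_INR|apply pow2_ge_0]. Qed.

Lemma weighted_l2_bounded (a : nat -> C) :
  weighted_l2 a -> exists M, forall n, (Cmod (a n) <= M)%R.
Proof.
  intros [L HL]. exists (L + 1)%R. intros n.
  assert (H : (INR (S n) * Cmod (a n) ^ 2 <= L)%R).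
  { eapply Rle_trans; [|apply (sum_n_le_series _ _ n (weight_term_ge_0 a) HL)].
    apply (term_le_sum_n _ n (weight_term_ge_0 a)). }
  rewrite S_INR in H.
  assert (0 <= INR n * Cmod (a n) ^ 2)%R
    by (apply Rmult_le_pos; [apply pos_INR|apply pow2_ge_0]).
  generalize (pow2_ge_0 (Cmod (a n))) (pow2_ge_0 (Cmod (a n) - 1)). lra.
Qed.

Lemma weighted_l2_le (a b : nat -> C) :
  (forall n, Cmod (a n) <= Cmod (b n))%R -> weighted_l2 b -> weighted_l2 a.
Proof.
  intros Hab. apply (@ex_series_le R_AbsRing R_CompleteNormedModule). intros n.
  change (Rabs (INR (S n) * Cmod (a n) ^ 2) <= INR (S n) * Cmod (b n) ^ 2)%R.
  rewrite Rabs_pos_eq by apply weight_term_ge_0.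
  apply Rmult_le_compat_l; [apply pos_INR|].
  apply pow_incr. split; [apply Cmod_ge_0|apply Hab].
Qed.

Lemma weighted_l2_lin (c d : C) (a b : nat -> C) :
  weighted_l2 a -> weighted_l2 b -> weighted_l2 (fun n => c * a n + d * b n).
Proof.
  intros Ha Hb.
  apply (@ex_series_le R_AbsRing R_CompleteNormedModule) with
    (b := fun n => (2 * Cmod c ^ 2 * (INR (S n) * Cmod (a n) ^ 2) +
                    2 * Cmod d ^ 2 * (INR (S n) * Cmod (b n) ^ 2))%R).
  - intros n.
    change (Rabs (INR (S n) * Cmod (c * a n + d * b n) ^ 2) <=
      2 * Cmod c ^ 2 * (INR (S n) * Cmod (a n) ^ 2) +
      2 * Cmod d ^ 2 * (INR (S n) * Cmod (b n) ^ 2))%R.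
    rewrite Rabs_pos_eq by (apply Rmult_le_pos; [apply pos_INR|apply pow2_ge_0]).
    assert (T := Cmod_triangle (c * a n) (d * b n)). rewrite !Cmod_mult in T.
    assert (T0 := Cmod_ge_0 (c * a n + d * b n)).
    set (x := (Cmod c * Cmod (a n))%R) in *. set (y := (Cmod d * Cmod (b n))%R) in *.
    apply Rle_trans with (INR (S n) * (2 * x ^ 2 + 2 * y ^ 2))%R;
      [|right; unfold x, y; ring].
    apply Rmult_le_compat_l; [apply pos_INR|].
    apply Rle_trans with ((x + y) ^ 2)%R; [apply pow_incr; lra|].
    generalize (pow2_ge_0 (x - y)). lra.
  - apply (@ex_series_plus R_AbsRing R_NormedModule);
      now apply (@ex_series_scal_l R_AbsRing R_NormedModule).
Qed.

Lemma CPSeries_on_disc (a : nat -> C) :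
  weighted_l2 a -> power_series_on_disc a (CPSeries a).
Proof.
  intros Ha. destruct (weighted_l2_bounded a Ha) as [M HM].
  now apply CPSeries_correct with M.
Qed.

(** Weighted square-summability bounds the coefficients, and boundedness gives
    convergence and differentiability on the disc. *)
Lemma dirichlet_CPSeries (a : nat -> C) : weighted_l2 a -> dirichlet (CPSeries a).
Proof.
  intros Ha. split.
  - destruct (weighted_l2_bounded a Ha) as [M HM].
    now apply CPSeries_holomorphic with M.
  - exists a. split; [now apply CPSeries_on_disc|exact Ha].
Qed.

Lemma power_series_ext (a : nat -> C) (f g : C -> C) :
  (forall z, unit_disc z -> f z = g z) ->
  power_series_on_disc a f -> power_series_on_disc a g.
Proof. intros E Hf z Hz. rewrite <- E by trivial. now apply Hf. Qed.

Lemma power_series_lin (c d : C) (a b : nat -> C) (f g : C -> C) :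
  power_series_on_disc a f -> power_series_on_disc b g ->
  power_series_on_disc (fun n => c * a n + d * b n) (fun z => c * f z + d * g z).
Proof.
  intros Ha Hb z Hz. apply is_Cpseries_iff.
  generalize (is_Cseries_plus _ _ _ _
    (is_Cseries_scal c _ _ (proj1 (is_Cpseries_iff _ _ _) (Ha z Hz)))
    (is_Cseries_scal d _ _ (proj1 (is_Cpseries_iff _ _ _) (Hb z Hz)))).
  apply is_Cseries_ext. intros n. ring.
Qed.

Lemma dirichlet_ext (f g : C -> C) :
  (forall z, unit_disc z -> f z = g z) -> dirichlet f -> dirichlet g.
Proof.
  intros E [Hf (a & Ha & Sa)]. split.
  - intros z Hz. apply ex_derive_ext_loc with (2 := Hf z Hz).
    assert (Hd : (0 < 1 - Cmod z)%R) by (unfold unit_disc in Hz; lra).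
    exists (mkposreal _ Hd). intros w Hw.
    change (Cmod (w - z) < 1 - Cmod z)%R in Hw.
    apply E. unfold unit_disc. replace w with (z + (w - z)) by ring.
    apply Rle_lt_trans with (1 := Cmod_triangle _ _). lra.
  - exists a. split; trivial. now apply power_series_ext with f.
Qed.

Lemma dirichlet_lin (c d : C) (f g : C -> C) :
  dirichlet f -> dirichlet g -> dirichlet (fun z => c * f z + d * g z).
Proof.
  intros [Hf (a & Ha & Sa)] [Hg (b & Hb & Sb)].
  (* Differentiability is read off the combined power series. *)
  apply dirichlet_ext with (CPSeries (fun n => c * a n + d * b n)).
  - intros z Hz.
    apply (is_Cseries_unique (fun n => (c * a n + d * b n) * z ^ n)).
    + apply is_Cpseries_iff. apply CPSeries_on_disc; [now apply weighted_l2_lin|exact Hz].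
    + apply is_Cpseries_iff. now apply (power_series_lin c d a b f g).
  - apply dirichlet_CPSeries. now apply weighted_l2_lin.
Qed.

Lemma dirichlet_scal (c : C) (f : C -> C) :
  dirichlet f -> dirichlet (fun z => c * f z).
Proof.
  intros Hf. apply dirichlet_ext with (fun z => c * f z + 0 * f z).
  - intros z _. ring.
  - now apply dirichlet_lin.
Qed.

(** * The inner product *)

Definition inner_term (a b : nat -> C) (n : nat) : C :=
  RtoC (INR (S n)) * a n * Cconj (b n).

Lemma inner_coef (f g : C -> C) (w : C) (a b : nat -> C) :
  is_dirichlet_inner f g w ->
  power_series_on_disc a f -> power_series_on_disc b g ->
  is_Cseries (inner_term a b) w.
Proof.
  intros (_ & _ & a' & b' & Ha' & Hb' & S) Ha Hb.
  apply is_Cseries_ext with (2 := S). intros n. unfold inner_term.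
  now rewrite (power_series_coef_unique _ _ _ Ha Ha' n),
              (power_series_coef_unique _ _ _ Hb Hb' n).
Qed.

Lemma inner_exists (f g : C -> C) :
  dirichlet f -> dirichlet g -> exists w, is_dirichlet_inner f g w.
Proof.
  intros Hf Hg. destruct (Hf) as [_ (a & Ha & Sa)]. destruct (Hg) as [_ (b & Hb & Sb)].
  exists (CSeries (inner_term a b)). split; [exact Hf|split; [exact Hg|]].
  exists a, b. split; [exact Ha|split; [exact Hb|]].
  apply CSeries_correct with
    (fun n => INR (S n) * Cmod (a n) ^ 2 + INR (S n) * Cmod (b n) ^ 2)%R.
  - intros n. unfold inner_term.
    rewrite !Cmod_mult, Cmod_conj, Cmod_R, Rabs_pos_eq by apply pos_INR.
    rewrite Rmult_assoc, <- Rmult_plus_distr_l.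
    apply Rmult_le_compat_l; [apply pos_INR|].
    generalize (Cmod_ge_0 (a n)) (Cmod_ge_0 (b n)). nra.
  - now apply (@ex_series_plus R_AbsRing R_NormedModule).
Qed.

Lemma inner_unique (f g : C -> C) (w w' : C) :
  is_dirichlet_inner f g w -> is_dirichlet_inner f g w' -> w = w'.
Proof.
  intros H H'. destruct (H) as (_ & _ & a & b & Ha & Hb & S).
  apply is_Cseries_unique with (1 := S). exact (inner_coef _ _ _ _ _ H' Ha Hb).
Qed.

Lemma inner_ext (f f' g g' : C -> C) (w : C) :
  (forall z, unit_disc z -> f z = f' z) -> (forall z, unit_disc z -> g z = g' z) ->
  is_dirichlet_inner f g w -> is_dirichlet_inner f' g' w.
Proof.
  intros Ef Eg (Hf & Hg & a & b & Ha & Hb & S).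
  split; [now apply dirichlet_ext with f|split; [now apply dirichlet_ext with g|]].
  exists a, b. split; [now apply power_series_ext with f|].
  split; [now apply power_series_ext with g|exact S].
Qed.

Lemma inner_lin_l (c d : C) (f g h : C -> C) (u v : C) :
  is_dirichlet_inner f h u -> is_dirichlet_inner g h v ->
  is_dirichlet_inner (fun z => c * f z + d * g z) h (c * u + d * v).
Proof.
  intros Hu Hv. destruct (Hu) as (Hf & Hh & a & e & Ha & He & Su).
  destruct (Hv) as (Hg & _ & b & _ & Hb & _ & _).
  assert (Sv := inner_coef _ _ _ _ _ Hv Hb He).
  split; [now apply dirichlet_lin|split; [exact Hh|]].
  exists (fun n => c * a n + d * b n), e.
  split; [now apply power_series_lin|split; [exact He|]].
  generalize (is_Cseries_plus _ _ _ _ (is_Cseries_scal c _ _ Su) (is_Cseries_scal d _ _ Sv)).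
  apply is_Cseries_ext. intros n. unfold inner_term. ring.
Qed.

Lemma inner_conj (f g : C -> C) (w : C) :
  is_dirichlet_inner f g w -> is_dirichlet_inner g f (Cconj w).
Proof.
  intros (Hf & Hg & a & b & Ha & Hb & Hs).
  split; [exact Hg|split; [exact Hf|]]. exists b, a.
  split; [exact Hb|split; [exact Ha|]].
  generalize (is_Cseries_conj _ _ Hs). apply is_Cseries_ext. intros n.
  rewrite !Cmult_conj, Cconj_conj, Cconj_RtoC. ring.
Qed.

Lemma inner_lin_r (c d : C) (f g h : C -> C) (u v : C) :
  is_dirichlet_inner h f u -> is_dirichlet_inner h g v ->
  is_dirichlet_inner h (fun z => c * f z + d * g z) (Cconj c * u + Cconj d * v).
Proof.
  intros Hu Hv.
  generalize (inner_conj _ _ _ (inner_lin_l c d _ _ _ _ _ (inner_conj _ _ _ Hu) (inner_conj _ _ _ Hv))).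
  now rewrite Cplus_conj, !Cmult_conj, !Cconj_conj.
Qed.

Lemma inner_scal (c d : C) (f g : C -> C) (w : C) :
  is_dirichlet_inner f g w ->
  is_dirichlet_inner (fun z => c * f z) (fun z => d * g z) (c * Cconj d * w).
Proof.
  intros H.
  assert (K := inner_lin_l c 0 _ _ _ _ _ H H).
  assert (K2 := inner_lin_r d 0 _ _ _ _ _ K K).
  replace (c * Cconj d * w) with (Cconj d * (c * w + 0 * w) + Cconj 0 * (c * w + 0 * w)).
  - apply inner_ext with (3 := K2); intros z _; ring.
  - rewrite Cconj_RtoC. ring.
Qed.

(** Definiteness holds on the disc only, since functions are compared there. *)
Lemma inner_self (f : C -> C) : dirichlet f ->
  exists t : R, (0 <= t)%R /\ is_dirichlet_inner f f (RtoC t) /\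
    (t = 0%R -> forall z, unit_disc z -> f z = 0).
Proof.
  intros Hf. destruct (Hf) as [_ (a & Ha & [t Ht])].
  assert (P := weight_term_ge_0 a).
  assert (T : forall n, (INR (S n) * Cmod (a n) ^ 2 <= t)%R).
  { intros n. eapply Rle_trans; [|apply (sum_n_le_series _ _ n P Ht)].
    apply (term_le_sum_n _ n P). }
  exists t. split; [|split].
  - exact (Rle_trans _ _ _ (P 0%nat) (T 0%nat)).
  - split; [exact Hf|split; [exact Hf|]]. exists a, a.
    split; [exact Ha|split; [exact Ha|]].
    generalize (is_Cseries_RtoC _ _ Ht). apply is_Cseries_ext. intros n.
    now rewrite RtoC_mult, Cmod2_conj, Cmult_assoc.
  - intros t0 z Hz.
    assert (a0 : forall n, a n = 0).
    { intros n. apply Cmod_eq_0. generalize (T n) (Cmod_ge_0 (a n)) (pos_INR n).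
      rewrite t0, S_INR. intros. nra. }
    apply (is_Cseries_unique (fun n => a n * z ^ n)).
    + apply is_Cpseries_iff, Ha, Hz.
    + generalize (is_Cseries_scal 0 _ _ (proj1 (is_Cpseries_iff _ _ _) (Ha z Hz))).
      replace (0 * f z) with (RtoC 0) by ring.
      apply is_Cseries_ext. intros n. rewrite a0. ring.
Qed.

Lemma inner_self_norm (f : C -> C) :
  is_dirichlet_norm f 1 <-> is_dirichlet_inner f f 1.
Proof.
  unfold is_dirichlet_norm. replace (1 ^ 2)%R with 1%R by ring. split.
  - tauto.
  - intros H. split; [lra|exact H].
Qed.

(** * The Toeplitz-Hausdorff theorem *)

Lemma inner_quad (al be : C) (f f' g g' : C -> C) (p a b q : C) :
  is_dirichlet_inner f' f p -> is_dirichlet_inner f' g a ->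
  is_dirichlet_inner g' f b -> is_dirichlet_inner g' g q ->
  is_dirichlet_inner (fun z => al * f' z + be * g' z) (fun z => al * f z + be * g z)
    (al * Cconj al * p + al * Cconj be * a + be * Cconj al * b + be * Cconj be * q).
Proof.
  intros Hp Ha Hb Hq.
  replace (al * Cconj al * p + al * Cconj be * a + be * Cconj al * b + be * Cconj be * q)
    with (Cconj al * (al * p + be * b) + Cconj be * (al * a + be * q)) by ring.
  apply inner_lin_r; now apply inner_lin_l.
Qed.

(** The imaginary part of [la A + Cconj la B] is that of [la (A - Cconj B)], so
    [la] is chosen to rotate [A - Cconj B] onto the nonnegative real axis. *)
Lemma rotate_to_real (A B : C) :
  exists (la : C) (x : R), la * Cconj la = 1 /\ la * A + Cconj la * B = RtoC x.
Proof.
  destruct (Ceq_dec (A - Cconj B) 0) as [H0|H0].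
  - exists 1, (2 * Re A)%R. rewrite Cconj_RtoC. split; [ring|].
    assert (E : B = Cconj A).
    { rewrite <- (Cconj_conj B). f_equal.
      replace (Cconj B) with (A - (A - Cconj B)) by ring. rewrite H0. ring. }
    rewrite E, RtoC_mult, re_alt. field.
  - set (D := A - Cconj B) in *.
    assert (Hd : Cmod D <> 0%R) by (intros H; now apply H0, Cmod_eq_0).
    assert (Hd' : RtoC (Cmod D) <> 0) by (intros H; apply Hd; now injection H).
    exists (Cconj D / Cmod D).
    exists (Cmod D + 2 * Re (Cconj D / Cmod D * Cconj B))%R.
    assert (Ec : Cconj (Cconj D / Cmod D) = D / Cmod D).
    { rewrite Cdiv_conj by trivial. now rewrite Cconj_conj, Cconj_RtoC. }
    assert (Em : D * Cconj D = Cmod D * Cmod D).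
    { rewrite <- Cmod2_conj, <- RtoC_mult. f_equal. ring. }
    split.
    + rewrite Ec. transitivity (D * Cconj D / (Cmod D * Cmod D)).
      * field; trivial.
      * rewrite Em. field; trivial.
    + rewrite RtoC_plus, RtoC_mult, re_alt, Cmult_conj, Ec, Cconj_conj.
      assert (EA : A = D + Cconj B) by (unfold D; ring).
      rewrite EA at 1.
      transitivity (D * Cconj D / Cmod D + (Cconj D / Cmod D * Cconj B + D / Cmod D * B)).
      * field; trivial.
      * rewrite Em. field; trivial.
Qed.

(** Toeplitz-Hausdorff. Let the unit vectors [f], [g] give the values [p <> q].
    After a suitable choice of the phase [la], the values at the normalised
    vectors [s la f + (1 - s) g], [0 <= s <= 1], stay on the line through [p]
    and [q] and move continuously from [q] to [p], so they cover the segment.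
    These vectors do not vanish: otherwise [f] and [g] would be proportional and
    [p = q]. *)
Lemma numerical_range_convex (T : (C -> C) -> C -> C) :
  bounded_operator T -> convex_set (numerical_range dirichlet T).
Proof.
  intros (TD & TL & M & TM) p q t (f & Df & Nf & Hp) (g & Dg & Ng & Hq) Ht.
  destruct (Ceq_dec p q) as [<-|Hpq].
  { exists f. split; [exact Df|split; [exact Nf|]].
    replace (t * p + (1 - t)%R * p) with p; [exact Hp|].
    rewrite RtoC_minus. ring. }
  apply inner_self_norm in Nf. apply inner_self_norm in Ng.
  assert (Hd : p - q <> 0).
  { intros H. apply Hpq. replace p with (p - q + q) by ring. rewrite H. ring. }
  destruct (inner_exists (T f) g (TD _ Df) Dg) as [a Ha].
  destruct (inner_exists (T g) f (TD _ Dg) Df) as [b Hb].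
  destruct (inner_exists f g Df Dg) as [ga Hga].
  assert (Hga' := inner_conj _ _ _ Hga).
  destruct (rotate_to_real ((a - q * ga) / (p - q)) ((b - q * Cconj ga) / (p - q)))
    as (la & x & Hla & Hx).
  set (c := Re (la * ga)).
  assert (Hc : la * ga + Cconj la * Cconj ga = RtoC (2 * c)).
  { unfold c. rewrite RtoC_mult, re_alt, Cmult_conj. field. }
  set (N := fun s : R => (s * s + (1 - s) * (1 - s) + s * (1 - s) * (2 * c))%R).
  (* [N s] is the squared norm of [s la f + (1 - s) g], and [F s / N s] is the
     coordinate, on the line from [q] to [p], of the value at the normalised
     vector, minus its target [t]. *)
  set (F := fun s : R => (s * s + s * (1 - s) * x - t * N s)%R).
  assert (FC : continuity F) by (unfold F, N; reg).
  destruct (IVT_cor F 0 1 FC) as (s & Hs & Fs).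
  { lra. }
  { unfold F, N. nra. }
  (* [k] is the normalising factor: 1 to see that [N s] is positive, then
     [/ sqrt (N s)]. *)
  assert (Q : forall k : R,
    is_dirichlet_inner (fun z => (k * s * la) * f z + (k * (1 - s)%R) * g z)
      (fun z => (k * s * la) * f z + (k * (1 - s)%R) * g z) (RtoC (k * k * N s))
    /\ is_dirichlet_inner (T (fun z => (k * s * la) * f z + (k * (1 - s)%R) * g z))
      (fun z => (k * s * la) * f z + (k * (1 - s)%R) * g z)
      ((t * p + (1 - t)%R * q) * RtoC (k * k * N s))).
  { intros k.
    assert (E1 := inner_quad (k * s * la) (k * (1 - s)%R) _ _ _ _ _ _ _ _ Nf Hga Hga' Ng).
    assert (E2 := inner_quad (k * s * la) (k * (1 - s)%R) _ _ _ _ _ _ _ _ Hp Ha Hb Hq).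
    rewrite !Cmult_conj, !Cconj_RtoC in E1, E2.
    assert (V1 : k * s * la * (k * s * Cconj la) * 1 + k * s * la * (k * (1 - s)%R) * ga +
       k * (1 - s)%R * (k * s * Cconj la) * Cconj ga +
       k * (1 - s)%R * (k * (1 - s)%R) * 1 = RtoC (k * k * N s)).
    { unfold N. rewrite !RtoC_mult, !RtoC_plus, !RtoC_mult.
      rewrite RtoC_mult in Hc. rewrite <- Hc.
      transitivity (k * k * s * s * (la * Cconj la) +
        k * k * (s * (1 - s)%R * (la * ga + Cconj la * Cconj ga) + (1 - s)%R * (1 - s)%R)).
      - ring.
      - rewrite Hla. ring. }
    assert (V2 : k * s * la * (k * s * Cconj la) * p + k * s * la * (k * (1 - s)%R) * a +
       k * (1 - s)%R * (k * s * Cconj la) * b +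
       k * (1 - s)%R * (k * (1 - s)%R) * q =
       (t * p + (1 - t)%R * q) * RtoC (k * k * N s)).
    { set (LHS := _ + _ + _ + _) at 1.
      assert (V3 : LHS - q * RtoC (k * k * N s) = (p - q) * RtoC (k * k * (s * s + s * (1 - s) * x))).
      { unfold LHS. rewrite <- V1.
        rewrite !RtoC_mult, !RtoC_plus, !RtoC_mult, <- Hx.
        transitivity (k * k * s * s * (la * Cconj la) * (p - q) +
          k * k * s * (1 - s)%R * (la * (a - q * ga) + Cconj la * (b - q * Cconj ga))).
        - ring.
        - rewrite Hla. field. exact Hd. }
      replace (s * s + s * (1 - s) * x)%R with (t * N s)%R in V3
        by (unfold F in Fs; lra).
      replace LHS with (LHS - q * RtoC (k * k * N s) + q * RtoC (k * k * N s)) by ring.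
      rewrite V3, !RtoC_mult, !RtoC_minus. ring. }
    rewrite V1 in E1. rewrite V2 in E2. split; [exact E1|].
    apply inner_ext with (3 := E2); [|reflexivity].
    intros z Hz. symmetry. now apply TL. }
  assert (N0 : (0 < N s)%R).
  { destruct (Q 1%R) as [Q1 _].
    set (v := fun z : C => 1%R * s * la * f z + 1%R * (1 - s)%R * g z) in Q1.
    destruct (inner_self v (proj1 Q1)) as (n & n0 & Hn & Hz).
    assert (En := inner_unique _ _ _ _ Q1 Hn).
    injection En as En. rewrite !Rmult_1_l in En.
    destruct (Rle_lt_or_eq_dec _ _ n0) as [n0'|n0']; [lra|].
    exfalso. apply Hpq. specialize (Hz (eq_sym n0')).
    rewrite <- n0' in Hn.
    assert (NTv : is_dirichlet_norm v 0).
    { split; [lra|]. now replace (0 ^ 2)%R with 0%R by ring. }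
    (* A priori [T v] may depend on values of [v] off the disc; boundedness makes
       it vanish on the disc along with [v]. *)
    assert (Tz : forall z, unit_disc z -> T v z = 0).
    { destruct (inner_self (T v) (TD _ (proj1 Q1))) as (m & m0 & Hm & HTz).
      apply HTz.
      assert (B : (sqrt m <= M * 0)%R).
      { apply (TM v); [exact NTv|]. split; [apply sqrt_pos|].
        now rewrite pow2_sqrt. }
      apply sqrt_eq_0; trivial. generalize (sqrt_pos m). lra. }
    assert (S1 : forall z, unit_disc z -> s * la * f z = - (1 - s)%R * g z).
    { intros z Hz1. specialize (Hz z Hz1). unfold v in Hz.
      replace (s * la * f z) with (1%R * s * la * f z + 1%R * (1 - s)%R * g z - (1 - s)%R * g z) by ring.
      rewrite Hz. ring. }
    assert (S2 : forall z, unit_disc z -> s * la * T f z = - (1 - s)%R * T g z).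
    { intros z Hz1. specialize (Tz z Hz1). unfold v in Tz. rewrite TL in Tz by trivial.
      replace (s * la * T f z) with (1%R * s * la * T f z + 1%R * (1 - s)%R * T g z - (1 - s)%R * T g z) by ring.
      rewrite Tz. ring. }
    assert (W : forall f' g' w w', (forall z, unit_disc z -> s * la * f' z = - (1 - s)%R * g' z) ->
      is_dirichlet_inner f' f w -> is_dirichlet_inner g' g w' ->
      s * s * w = (1 - s)%R * (1 - s)%R * w').
    { intros f' g' w w' E Hw Hw'.
      assert (I1 := inner_scal (s * la) (s * la) _ _ _ Hw).
      assert (I2 := inner_scal (- (1 - s)%R) (- (1 - s)%R) _ _ _ Hw').
      apply (inner_ext _ _ _ _ _ E S1) in I1.
      generalize (inner_unique _ _ _ _ I1 I2).
      rewrite Copp_conj, Cmult_conj, !Cconj_RtoC. intros E'.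
      transitivity (s * s * (la * Cconj la) * w).
      - rewrite Hla. ring.
      - transitivity (s * la * (s * Cconj la) * w); [ring|]. rewrite E'. ring. }
    assert (W1 := W _ _ _ _ S1 Nf Ng). assert (W2 := W _ _ _ _ S2 Hp Hq).
    rewrite !Cmult_1_r, <- !RtoC_mult in W1. injection W1 as W1.
    assert (Es : s = (1/2)%R) by lra.
    rewrite Es in W2. replace (1 - 1/2)%R with (1/2)%R in W2 by lra.
    rewrite <- !RtoC_mult in W2. replace (1/2 * (1/2))%R with (/4)%R in W2 by field.
    rewrite RtoC_inv in W2 by lra.
    replace p with (4 * (/4 * p)) by (field; intros H; injection H; lra).
    rewrite W2. field; intros H; injection H; lra. }
  destruct (Q (/ sqrt (N s))%R) as [Q1 Q2].
  replace (/ sqrt (N s) * / sqrt (N s) * N s)%R with 1%R in Q1, Q2.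
  - eexists. split; [exact (proj1 Q1)|]. split; [apply inner_self_norm, Q1|].
    rewrite Cmult_1_r in Q2. exact Q2.
  - rewrite <- Rinv_mult, sqrt_sqrt by lra. field. lra.
Qed.

(** * Finite orthogonal sums *)

Fixpoint Csum (n : nat) (u : nat -> C) : C :=
  match n with O => 0 | S n => Csum n u + u n end.

Lemma Csum_mult_l (n : nat) (c : C) (u : nat -> C) :
  Csum n (fun j => c * u j) = c * Csum n u.
Proof.
  induction n as [|n IH]; simpl; [ring|]. rewrite IH. ring.
Qed.

Lemma Csum_mult_r (n : nat) (c : C) (u : nat -> C) :
  Csum n (fun j => u j * c) = Csum n u * c.
Proof.
  induction n as [|n IH]; simpl; [ring|]. rewrite IH. ring.
Qed.

Lemma Csum_delta (n m : nat) (c : C) :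
  Csum n (fun j => if Nat.eqb m j then c else 0) = if Nat.ltb m n then c else 0.
Proof.
  induction n as [|n IH]; [reflexivity|]. simpl Csum. rewrite IH.
  destruct (Nat.ltb_spec m n), (Nat.eqb_spec m n), (Nat.ltb_spec m (S n));
    try lia; ring.
Qed.

Lemma is_Cseries_0 : is_Cseries (fun _ => RtoC 0) (RtoC 0).
Proof.
  assert (H := is_Cseries_RtoC _ _ (is_series_geom 0 ltac:(rewrite Rabs_R0; lra))).
  generalize (is_Cseries_scal 0 _ _ H). rewrite Cmult_0_l.
  apply is_Cseries_ext. intros n. ring.
Qed.

Lemma is_Cseries_Csum (m : nat) (a : nat -> nat -> C) (l : nat -> C) :
  (forall j, (j < m)%nat -> is_Cseries (a j) (l j)) ->
  is_Cseries (fun n => Csum m (fun j => a j n)) (Csum m l).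
Proof.
  intros H. induction m as [|m IH]; simpl; [apply is_Cseries_0|].
  apply is_Cseries_plus; auto.
Qed.

Lemma dirichlet_0 : dirichlet (fun _ => 0).
Proof.
  assert (W : weighted_l2 (fun _ => 0)).
  { apply (@ex_series_ext R_AbsRing R_NormedModule) with (fun n => scal 0%R (0 ^ n)%R).
    - intros n. change (0 * 0 ^ n = INR (S n) * Cmod 0 ^ 2)%R. rewrite Cmod_0. ring.
    - apply (@ex_series_scal_l R_AbsRing R_NormedModule 0%R).
      eexists. apply is_series_geom. rewrite Rabs_R0. lra. }
  apply dirichlet_ext with (2 := dirichlet_CPSeries _ W). intros z Hz.
  generalize (CPSeries_on_disc _ W z Hz). rewrite is_Cpseries_iff. intros H.
  apply is_Cseries_unique with (1 := H). apply is_Cseries_ext with (2 := is_Cseries_0).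
  intros n. ring.
Qed.

Lemma inner_0 (f : C -> C) : dirichlet f -> is_dirichlet_inner (fun _ => 0) f 0.
Proof.
  intros Hf. destruct (inner_exists f f Hf Hf) as [w Hw].
  assert (H := inner_lin_l 0 0 _ _ _ _ _ Hw Hw).
  replace (0 * w + 0 * w) with (RtoC 0) in H by ring.
  apply inner_ext with (3 := H); intros z _; ring.
Qed.

Lemma inner_Csum_l (n : nat) (h : nat -> C -> C) (k : C -> C) (u : nat -> C) :
  dirichlet k -> (forall j, (j < n)%nat -> is_dirichlet_inner (h j) k (u j)) ->
  is_dirichlet_inner (fun z => Csum n (fun j => h j z)) k (Csum n u).
Proof.
  intros Hk H. induction n as [|n IH]; simpl; [now apply inner_0|].
  assert (E := inner_lin_l 1 1 _ _ _ _ _ (IH (fun j Hj => H j (Nat.lt_lt_succ_r _ _ Hj)))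
                 (H n (Nat.lt_succ_diag_r n))).
  rewrite !Cmult_1_l in E. apply inner_ext with (3 := E); intros z _; ring.
Qed.

Lemma inner_orthogonal_Csum (n : nat) (h k : nat -> C -> C) (u : nat -> C) :
  (forall j, (j < n)%nat -> is_dirichlet_inner (h j) (k j) (u j)) ->
  (forall i j, (i < n)%nat -> (j < n)%nat -> i <> j -> is_dirichlet_inner (h i) (k j) 0) ->
  is_dirichlet_inner (fun z => Csum n (fun j => h j z)) (fun z => Csum n (fun j => k j z))
    (Csum n u).
Proof.
  intros Hu Ho.
  assert (Dk : forall m, (m <= n)%nat -> dirichlet (fun z => Csum m (fun j => k j z))).
  { induction m as [|m IH]; intros Hm; simpl; [apply dirichlet_0|].
    apply dirichlet_ext with (fun z => 1 * Csum m (fun j => k j z) + 1 * k m z).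
    - intros z _. ring.
    - apply dirichlet_lin; [apply IH; lia|]. apply (Hu m); lia. }
  apply inner_Csum_l; [now apply Dk|]. intros i Hi.
  assert (H : forall m, (m <= n)%nat ->
    is_dirichlet_inner (h i) (fun z => Csum m (fun j => k j z))
      (Csum m (fun j => if Nat.eqb i j then u i else 0))).
  { induction m as [|m IH]; intros Hm; simpl.
    - generalize (inner_conj _ _ _ (inner_0 (h i) (proj1 (Hu i Hi)))).
      now rewrite Cconj_RtoC.
    - assert (Hk : is_dirichlet_inner (h i) (k m) (if Nat.eqb i m then u i else 0)).
      { destruct (Nat.eqb_spec i m) as [<-|Him]; [now apply Hu|apply Ho; lia]. }
      assert (E := inner_lin_r 1 1 _ _ _ _ _ (IH ltac:(lia)) Hk).
      rewrite !Cconj_RtoC, !Cmult_1_l in E.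
      apply inner_ext with (3 := E); intros z _; ring. }
  generalize (H n (le_n n)). rewrite Csum_delta.
  now rewrite (proj2 (Nat.ltb_lt i n) Hi).
Qed.

(** * Eigenfunctions of the rotation *)

Definition homogeneous (mu : C) (j : nat) (h : C -> C) : Prop :=
  forall z, unit_disc z -> h (mu * z) = mu ^ j * h z.

Lemma unit_disc_rotate (mu z : C) : Cmod mu = 1%R -> unit_disc z -> unit_disc (mu * z).
Proof. unfold unit_disc. intros H. now rewrite Cmod_mult, H, Rmult_1_l. Qed.

(** Both sides are the [n]th Taylor coefficient of [z |-> h (mu z)]. *)
Lemma homogeneous_coef (mu : C) (j : nat) (h : C -> C) (a : nat -> C) :
  Cmod mu = 1%R -> homogeneous mu j h -> power_series_on_disc a h ->
  forall n, mu ^ n * a n = mu ^ j * a n.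
Proof.
  intros Hmu Hh Ha. apply power_series_coef_unique with (fun z => mu ^ j * h z).
  - intros z Hz. rewrite <- Hh by trivial. apply is_Cpseries_iff.
    generalize (proj1 (is_Cpseries_iff _ _ _) (Ha _ (unit_disc_rotate mu z Hmu Hz))).
    apply is_Cseries_ext. intros n. rewrite Cpow_mult_l. ring.
  - intros z Hz. apply is_Cpseries_iff.
    generalize (is_Cseries_scal (mu ^ j) _ _ (proj1 (is_Cpseries_iff _ _ _) (Ha z Hz))).
    apply is_Cseries_ext. intros n. ring.
Qed.

(** For each [n] at most one of [mu ^ i], [mu ^ j] equals [mu ^ n], so at most
    one of the two [n]th coefficients is nonzero. *)
Lemma homogeneous_orthogonal (mu : C) (i j : nat) (h k : C -> C) :
  Cmod mu = 1%R -> mu ^ i <> mu ^ j ->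
  homogeneous mu i h -> homogeneous mu j k -> dirichlet h -> dirichlet k ->
  is_dirichlet_inner h k 0.
Proof.
  intros Hmu Hij Hh Hk Dh Dk.
  destruct (Dh) as [_ (a & Ha & _)]. destruct (Dk) as [_ (b & Hb & _)].
  split; [exact Dh|split; [exact Dk|]]. exists a, b.
  split; [exact Ha|split; [exact Hb|]].
  apply is_Cseries_ext with (2 := is_Cseries_0). intros n.
  assert (Ea := homogeneous_coef _ _ _ _ Hmu Hh Ha n).
  assert (Eb := homogeneous_coef _ _ _ _ Hmu Hk Hb n).
  assert (V : forall (l : nat) (x : C), mu ^ n * x = mu ^ l * x -> mu ^ n <> mu ^ l -> x = 0).
  { intros l x E Hne.
    destruct (Ceq_dec x 0) as [|Hx]; [assumption|]. exfalso. apply Hne.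
    replace (mu ^ n) with (mu ^ n * x / x) by (field; trivial).
    rewrite E. field; trivial. }
  destruct (Ceq_dec (mu ^ n) (mu ^ i)) as [Hn|Hn].
  - rewrite (V j (b n) Eb) by congruence. rewrite Cconj_RtoC. ring.
  - rewrite (V i (a n) Ea) by exact Hn. ring.
Qed.

(** * Splitting a function along residue classes of the exponents *)

(** The partial sums of the thinned series are the partial sums of [b] of index
    [j + r N]: between two consecutive such indices only the last term counts. *)
Lemma is_series_sparse {K : AbsRing} {V : NormedModule K} (r j : nat) (b : nat -> V) (l : V) :
  (j < r)%nat -> (forall n, Nat.modulo n r <> j -> b n = zero) ->
  is_series b l -> is_series (fun k => b (j + r * k)%nat) l.
Proof.
  intros Hj Hb Hl.
  assert (E : forall N, sum_n b (j + r * N)%nat = sum_n (fun k => b (j + r * k)%nat) N).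
  { assert (Z : forall p q, (forall i, (p <= i < p + q)%nat -> Nat.modulo i r <> j) ->
              sum_n_m b p (p + q) = b (p + q)%nat).
    { intros p q H. destruct q as [|q].
      - rewrite Nat.add_0_r. apply sum_n_n.
      - rewrite Nat.add_succ_r, sum_n_Sm by lia.
        rewrite (sum_n_m_ext_loc _ (fun _ => zero)).
        + now rewrite sum_n_m_const_zero, plus_zero_l.
        + intros i Hi. apply Hb, H. lia. }
    induction N as [|N IH].
    - rewrite sum_O, Nat.mul_0_r, Nat.add_0_r.
      apply (Z 0%nat j). intros i Hi. rewrite Nat.mod_small; lia.
    - rewrite sum_Sn, <- IH. unfold sum_n.
      rewrite (sum_n_m_Chasles b 0 (j + r * N)) by nia. f_equal.
      replace (j + r * S N)%nat with (S (j + r * N) + (r - 1))%nat by nia.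
      apply Z. intros i Hi Hm.
      assert (D := Nat.div_mod_eq i r). rewrite Hm in D.
      assert (i / r <= N \/ S N <= i / r)%nat as [Hc|Hc] by lia; nia. }
  unfold is_series.
  apply filterlim_ext with (fun N => sum_n b (j + r * N)%nat); [exact E|].
  apply (filterlim_comp _ _ _ (fun N => j + r * N)%nat (sum_n b) eventually eventually).
  - apply eventually_subseq. intros n. nia.
  - exact Hl.
Qed.

Definition residue_part (r j : nat) (a : nat -> C) (n : nat) : C :=
  if Nat.eqb (Nat.modulo n r) j then a n else 0.

Lemma weighted_l2_residue_part (r j : nat) (a : nat -> C) :
  weighted_l2 a -> weighted_l2 (residue_part r j a).
Proof.
  apply weighted_l2_le. intros n. unfold residue_part.
  destruct (Nat.eqb _ _); [apply Rle_refl|]. rewrite Cmod_0. apply Cmod_ge_0.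
Qed.

Lemma Csum_residue_part (r : nat) (a : nat -> C) (n : nat) :
  (0 < r)%nat -> Csum r (fun j => residue_part r j a n) = a n.
Proof.
  intros Hr. unfold residue_part. rewrite Csum_delta.
  destruct (Nat.ltb_spec (n mod r) r) as [|H]; [reflexivity|].
  generalize (Nat.mod_upper_bound n r). lia.
Qed.

Lemma mod_residue (r j k : nat) : (j < r)%nat -> Nat.modulo (j + r * k) r = j.
Proof.
  intros H. rewrite (Nat.mul_comm r k), Nat.Div0.mod_add. now apply Nat.mod_small.
Qed.

(** The weight [k + 1] is at most the weight [j + r k + 1] at the original place
    of the coefficient. *)
Lemma weighted_l2_residue_sub (r j : nat) (a : nat -> C) :
  (j < r)%nat -> weighted_l2 a -> weighted_l2 (fun k => a (j + r * k)%nat).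
Proof.
  intros Hj Ha.
  destruct (weighted_l2_residue_part r j a Ha) as [L HL].
  apply (is_series_sparse r j) in HL; [|exact Hj|].
  - apply (@ex_series_le R_AbsRing R_CompleteNormedModule) with (2 := ex_intro _ L HL).
    intros k. unfold residue_part. rewrite mod_residue, Nat.eqb_refl by trivial.
    change (Rabs (INR (S k) * Cmod (a (j + r * k)%nat) ^ 2) <=
            INR (S (j + r * k)) * Cmod (a (j + r * k)%nat) ^ 2)%R.
    rewrite Rabs_pos_eq by (apply Rmult_le_pos; [apply pos_INR|apply pow2_ge_0]).
    apply Rmult_le_compat_r; [apply pow2_ge_0|]. apply le_INR. nia.
  - intros n Hn. unfold residue_part. rewrite (proj2 (Nat.eqb_neq _ _) Hn), Cmod_0.
    change (INR (S n) * 0 ^ 2 = 0)%R. ring.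
Qed.

Lemma unit_disc_pow (z : C) (r : nat) : (0 < r)%nat -> unit_disc z -> unit_disc (z ^ r).
Proof.
  unfold unit_disc. intros Hr Hz. rewrite Cmod_pow. apply pow_lt_1_compat; trivial.
  split; [apply Cmod_ge_0|exact Hz].
Qed.

Lemma P_space_residue_part (r j : nat) (a : nat -> C) :
  (j < r)%nat -> weighted_l2 a -> P_space r j (CPSeries (residue_part r j a)).
Proof.
  intros Hj Ha. assert (Hs := weighted_l2_residue_sub r j a Hj Ha).
  exists (CPSeries (fun k => a (j + r * k)%nat)). split; [now apply dirichlet_CPSeries|].
  intros z Hz.
  assert (H1 := CPSeries_on_disc _ (weighted_l2_residue_part r j a Ha) z Hz).
  assert (H2 := CPSeries_on_disc _ Hs (z ^ r) (unit_disc_pow z r ltac:(lia) Hz)).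
  rewrite is_Cpseries_iff in H1, H2.
  apply (is_series_sparse r j) in H1; [|exact Hj|].
  - apply is_Cseries_unique with (1 := H1).
    generalize (is_Cseries_scal (z ^ j) _ _ H2). apply is_Cseries_ext. intros k.
    unfold residue_part. rewrite mod_residue, Nat.eqb_refl by trivial.
    rewrite Cpow_add_r, Cpow_mult_r. ring.
  - intros n Hn. unfold residue_part. rewrite (proj2 (Nat.eqb_neq _ _) Hn).
    apply Cmult_0_l.
Qed.

Lemma Csum_residue_functions (r : nat) (a : nat -> C) (f : C -> C) :
  (0 < r)%nat -> weighted_l2 a -> power_series_on_disc a f ->
  forall z, unit_disc z -> Csum r (fun j => CPSeries (residue_part r j a) z) = f z.
Proof.
  intros Hr Ha Hf z Hz. apply (is_Cseries_unique (fun n => a n * z ^ n)).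
  - apply is_Cseries_ext with (fun n => Csum r (fun j => residue_part r j a n * z ^ n)).
    + intros n. now rewrite Csum_mult_r, Csum_residue_part.
    + apply is_Cseries_Csum. intros j _. apply is_Cpseries_iff.
      apply CPSeries_on_disc; trivial. now apply weighted_l2_residue_part.
  - apply is_Cpseries_iff. now apply Hf.
Qed.

Lemma P_space_homogeneous (mu : C) (r j : nat) (f : C -> C) :
  Cmod mu = 1%R -> mu ^ r = 1 -> P_space r j f -> homogeneous mu j f.
Proof.
  intros H1 Hr (g & _ & Hg) z Hz.
  rewrite !Hg by (trivial; now apply unit_disc_rotate).
  rewrite !Cpow_mult_l, Hr, Cmult_1_l. ring.
Qed.

Lemma P_space_scal (c : C) (r j : nat) (f : C -> C) :
  P_space r j f -> P_space r j (fun z => c * f z).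
Proof.
  intros (g & Dg & Hg). exists (fun z => c * g z). split; [now apply dirichlet_scal|].
  intros z Hz. rewrite Hg by trivial. ring.
Qed.

(** * Convex combinations *)

Lemma convex_hull_convex (S : C -> Prop) : convex_set (convex_hull S).
Proof.
  intros x y t Hx Hy Ht K HK HS. apply HK; trivial; [now apply Hx|now apply Hy].
Qed.

(** The division by the total weight keeps the induction inside [K]; zero
    weights are allowed because they come with zero vectors. *)
Lemma convex_set_Csum (K : C -> Prop) (n : nat) (t : nat -> R) (u : nat -> C) :
  convex_set K ->
  (forall j, (j < n)%nat -> (0 <= t j)%R) ->
  (forall j, (j < n)%nat -> t j = 0%R -> u j = 0) ->
  (forall j, (j < n)%nat -> (0 < t j)%R -> K (u j / t j)) ->
  exists T : R, Csum n (fun j => RtoC (t j)) = RtoC T /\ (0 <= T)%R /\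
    (T = 0%R -> Csum n u = 0) /\ ((0 < T)%R -> K (Csum n u / T)).
Proof.
  intros HK H0 Hz HP. induction n as [|n IH].
  { exists 0%R. repeat split; trivial; try lra. }
  destruct IH as (T & ET & T0 & TZ & TK); auto.
  exists (T + t n)%R. simpl. rewrite ET, RtoC_plus.
  specialize (H0 n (Nat.lt_succ_diag_r n)). specialize (Hz n (Nat.lt_succ_diag_r n)).
  specialize (HP n (Nat.lt_succ_diag_r n)).
  split; [reflexivity|split; [lra|split]].
  - intros E. rewrite TZ, Hz by lra. ring.
  - intros E.
    destruct (Rle_lt_or_eq_dec _ _ T0) as [T1|T1].
    + destruct (Rle_lt_or_eq_dec _ _ H0) as [t1|t1].
      * replace ((Csum n u + u n) / (T + t n)) with
          (RtoC (T / (T + t n)) * (Csum n u / T) + RtoC (1 - T / (T + t n)) * (u n / t n)).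
        -- apply HK; auto. split.
           ++ apply Rdiv_le_0_compat; lra.
           ++ apply Rmult_le_reg_r with (T + t n)%R; [lra|]. field_simplify; lra.
        -- replace (1 - T / (T + t n))%R with (t n / (T + t n))%R by (field; lra).
           rewrite !RtoC_div, !RtoC_plus by lra.
           field; repeat split; rewrite <- ?RtoC_plus; intros X; injection X; lra.
      * rewrite <- t1, (Hz (eq_sym t1)), !Cplus_0_r. auto.
    + rewrite <- T1, (TZ (eq_sym T1)), !Cplus_0_l. apply HP. lra.
Qed.

(** * Roots of unity *)

Lemma cexp_root_pow (r n : nat) : (0 < r)%nat ->
  cexp (RtoC 2 * RtoC PI * Ci / RtoC (INR r)) ^ n =
  (cos (2 * PI * INR n / INR r), sin (2 * PI * INR n / INR r)).
Proof.
  intros Hr. assert (Hr' : (INR r <> 0)%R) by (apply not_0_INR; lia).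
  assert (E : cexp (RtoC 2 * RtoC PI * Ci / RtoC (INR r)) =
              (cos (2 * PI / INR r), sin (2 * PI / INR r))).
  { replace (RtoC 2 * RtoC PI * Ci / RtoC (INR r)) with (0%R, (2 * PI / INR r)%R).
    - unfold cexp. simpl. rewrite exp_0, !Rmult_1_l. reflexivity.
    - unfold Cdiv. rewrite <- RtoC_inv by trivial. unfold Cmult, RtoC, Ci. simpl.
      f_equal; unfold Rdiv; ring. }
  rewrite E. induction n as [|n IH].
  - simpl. replace (2 * PI * 0 / INR r)%R with 0%R by (unfold Rdiv; ring).
    now rewrite cos_0, sin_0.
  - rewrite Cpow_S, IH, S_INR.
    replace (2 * PI * (INR n + 1) / INR r)%R with (2 * PI / INR r + 2 * PI * INR n / INR r)%R
      by (field; trivial).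
    rewrite cos_plus, sin_plus. unfold Cmult. simpl. f_equal; ring.
Qed.

(** [1 - cos (2 x) = 2 sin x ^ 2] with [x = PI n / r] strictly between 0 and [PI]. *)
Lemma cexp_root_pow_ne_1 (r n : nat) : (0 < n < r)%nat ->
  cexp (RtoC 2 * RtoC PI * Ci / RtoC (INR r)) ^ n <> 1.
Proof.
  intros [Hn Hr]. rewrite cexp_root_pow by lia. intros H. injection H as Hc _.
  assert (Hr' : (0 < INR r)%R) by (apply lt_0_INR; lia).
  assert (Hn' : (0 < INR n)%R) by (apply lt_0_INR; lia).
  assert (Hnr : (INR n < INR r)%R) by now apply lt_INR.
  replace (2 * PI * INR n / INR r)%R with (2 * (PI * (INR n / INR r)))%R in Hc
    by (field; lra).
  rewrite cos_2a_sin in Hc.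
  assert (P := PI_RGT_0).
  assert (0 < INR n / INR r < 1)%R.
  { split; [now apply Rdiv_lt_0_compat|]. apply Rlt_div_l; lra. }
  assert (S := sin_gt_0 (PI * (INR n / INR r)) ltac:(nra) ltac:(nra)).
  nra.
Qed.

Lemma root_pow_injective (mu : C) (r : nat) : mu <> 0 ->
  (forall n, (0 < n < r)%nat -> mu ^ n <> 1) ->
  forall i j, (i < r)%nat -> (j < r)%nat -> i <> j -> mu ^ i <> mu ^ j.
Proof.
  intros H0 H1.
  assert (W : forall i j, (i < j < r)%nat -> mu ^ i <> mu ^ j).
  { intros i j Hij E. apply (H1 (j - i)%nat); [lia|].
    replace j with (i + (j - i))%nat in E by lia. rewrite Cpow_add_r in E.
    assert (Hi := Cpow_nz _ i H0).
    replace (mu ^ (j - i)) with (mu ^ i * mu ^ (j - i) / mu ^ i) by (field; trivial).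
    rewrite <- E. field; trivial. }
  intros i j Hi Hj Hij E.
  destruct (Nat.lt_total i j) as [L|[L|L]]; [|lia|].
  - apply (W i j); [lia|exact E].
  - apply (W j i); [lia|now symmetry].
Qed.

(** * The numerical range of the weighted composition operator *)

Theorem theorem3p3 (r : nat) (hr : (2 <= r)%nat)
    (mu : C) (hmu : mu = cexp (RtoC 2 * RtoC PI * Ci / RtoC (INR r))%C)
    (phi : C -> C) (hphi : forall z : C, unit_disc z -> phi z = (mu * z)%C)
    (g : C -> C) (hg : multiplier g)
    (psi : C -> C) (hpsi : forall z : C, unit_disc z -> psi z = g (Cpow z r))
    (hC : bounded_operator (wcomp_op psi phi)) :
  forall w : C,
    numerical_range dirichlet (wcomp_op psi phi) w <->
    convex_hull
      (fun v : C => exists j : nat, (j < r)%nat /\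
         scale_set (Cpow mu j) (numerical_range (P_space r j) (mul_op psi)) v)
      w.
Proof.
  assert (mu_r : mu ^ r = 1).
  { rewrite hmu, cexp_root_pow by lia.
    replace (2 * PI * INR r / INR r)%R with (2 * PI)%R by (field; apply not_0_INR; lia).
    now rewrite cos_2PI, sin_2PI. }
  assert (mu_1 : Cmod mu = 1%R).
  { rewrite <- (Cpow_1_r mu), hmu, cexp_root_pow by lia.
    unfold Cmod. simpl fst; simpl snd.
    rewrite <- !Rsqr_pow2, Rplus_comm, sin2_cos2. apply sqrt_1. }
  assert (mu_0 : mu <> 0) by (intros H; rewrite H, Cmod_0 in mu_1; lra).
  assert (mu_inj := root_pow_injective mu r mu_0
    (fun n Hn => eq_ind_r (fun m => m ^ n <> 1) (cexp_root_pow_ne_1 r n Hn) hmu)).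
  set (T := wcomp_op psi phi) in *.
  assert (TD : forall f, dirichlet f -> dirichlet (T f)) by apply hC.
  assert (psi_mu : forall z, unit_disc z -> psi (mu * z) = psi z).
  { intros z Hz. rewrite !hpsi by (trivial; now apply unit_disc_rotate).
    now rewrite Cpow_mult_l, mu_r, Cmult_1_l. }
  assert (TP : forall j f, P_space r j f -> forall z, unit_disc z ->
                 T f z = mu ^ j * mul_op psi f z).
  { intros j f Hf z Hz. unfold T, wcomp_op, mul_op. rewrite hphi by trivial.
    rewrite (P_space_homogeneous mu r j f mu_1 mu_r Hf z Hz). ring. }
  intros w. split.
  - intros (f & Df & Nf & Hw). apply inner_self_norm in Nf.
    destruct (Df) as [_ (a & Ha & Sa)].
    set (F := fun j => CPSeries (residue_part r j a)).
    assert (DF : forall j, dirichlet (F j)).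
    { intros j. apply dirichlet_CPSeries. now apply weighted_l2_residue_part. }
    assert (PF : forall j, (j < r)%nat -> P_space r j (F j)).
    { intros j Hj. now apply P_space_residue_part. }
    assert (SF : forall z, unit_disc z -> Csum r (fun j => F j z) = f z).
    { apply Csum_residue_functions; trivial. lia. }
    destruct (functional_choice _ (fun j => inner_self (F j) (DF j))) as [t Ht].
    destruct (functional_choice _ (fun j => inner_exists (T (F j)) (F j) (TD _ (DF j)) (DF j)))
      as [u Hu].
    assert (HF : forall j, (j < r)%nat -> homogeneous mu j (F j)).
    { intros j Hj. now apply P_space_homogeneous with r; auto. }
    assert (HT : forall j, (j < r)%nat -> homogeneous mu j (T (F j))).
    { intros j Hj z Hz. rewrite !(TP j) by (auto; now apply unit_disc_rotate).
      unfold mul_op. rewrite psi_mu, HF by auto. ring. }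
    assert (St : Csum r (fun j => RtoC (t j)) = 1).
    { apply (inner_unique f f); [|exact Nf].
      apply inner_ext with (1 := SF) (2 := SF).
      apply inner_orthogonal_Csum.
      - intros j _. apply Ht.
      - intros i j Hi Hj Hij. apply homogeneous_orthogonal with mu i j; auto. }
    assert (Su : Csum r u = w).
    { apply (inner_unique (T f) f); [|exact Hw].
      assert (STF : forall z, unit_disc z -> Csum r (fun j => T (F j) z) = T f z).
      { intros z Hz. unfold T, wcomp_op. rewrite Csum_mult_l. f_equal. apply SF.
        rewrite hphi by trivial. now apply unit_disc_rotate. }
      apply inner_ext with (1 := STF) (2 := SF).
      apply inner_orthogonal_Csum.
      - intros j _. apply Hu.
      - intros i j Hi Hj Hij. apply homogeneous_orthogonal with mu i j; auto. }
    destruct (convex_set_Csum _ r t u (convex_hull_convex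
      (fun v : C => exists j : nat, (j < r)%nat /\
         scale_set (mu ^ j) (numerical_range (P_space r j) (mul_op psi)) v)))
      as (S & ES & _ & _ & KS).
    + intros j _. apply Ht.
    + (* a part of norm zero vanishes, and so does its value *)
      intros j _ tj. destruct (Ht j) as (_ & _ & Hz). specialize (Hz tj).
      apply (inner_unique (T (F j)) (F j)); [apply Hu|].
      assert (H := inner_scal 1 0 _ _ _ (Hu j)).
      rewrite Cconj_RtoC, Cmult_0_r, Cmult_0_l in H.
      apply inner_ext with (3 := H).
      * intros z _. ring.
      * intros z Hz1. rewrite Hz by trivial. ring.
    + intros j Hj tj K _ HK. apply HK. exists j. split; [exact Hj|].
      destruct (Ht j) as (_ & Htj & _).
      assert (Hmj := Cpow_nz mu j mu_0).
      assert (tj' : RtoC (t j) <> 0) by (intros X; injection X; lra).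
      exists (u j / t j / mu ^ j). split; [|field; auto].
      set (k := (/ sqrt (t j))%R).
      assert (Ek : k * k = / t j).
      { unfold k. rewrite <- RtoC_mult, <- Rinv_mult, sqrt_sqrt by lra.
        apply RtoC_inv. lra. }
      exists (fun z => k * F j z). split; [now apply P_space_scal, PF|split].
      * apply inner_self_norm.
        assert (H := inner_scal k k _ _ _ Htj).
        rewrite Cconj_RtoC, Ek in H. now rewrite Cinv_l in H.
      * assert (H := inner_scal (k / mu ^ j) k _ _ _ (Hu j)).
        rewrite Cconj_RtoC in H.
        replace (k / mu ^ j * k * u j) with (u j / t j / mu ^ j) in H.
        -- apply inner_ext with (3 := H); [|reflexivity].
           intros z Hz. rewrite (TP j) by auto. unfold mul_op. field. exact Hmj.
        -- transitivity (k * k * u j / mu ^ j); [|field; exact Hmj].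
           rewrite Ek. field; auto.
    + rewrite ES in St. injection St as St.
      rewrite Su, St in KS. replace w with (w / 1) by field. apply KS. lra.
  - intros Hw. apply Hw.
    + now apply numerical_range_convex.
    + intros v (j & Hj & s & (f & Pf & Nf & Hs) & ->).
      exists f. split; [apply Nf|split; [exact Nf|]].
      assert (H := inner_scal (mu ^ j) 1 _ _ _ Hs).
      rewrite Cconj_RtoC, Cmult_1_r in H.
      apply inner_ext with (3 := H).
      * intros z Hz. now rewrite (TP j).
      * intros z _. ring.
Qed.
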